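(* Let $n,r\in\mathbb{N}\setminus\{1\}$. Suppose $E$ is a uniformly complete vector lattice, $V$ is a vector space, and $P\colon E\to V$ is an $n$-homogeneous polynomial with associated symmetric $n$-linear map $\check{P}$. (i) If $P(\mathfrak{S}_{n}(f_{1},\dots,f_{r}))=\sum_{k=1}^rP(f_{k})$ holds for all $f_{1},\dots,f_{r}\in E^{+}$, then $P$ is orthogonally additive. (ii) If $P(\mathfrak{G}_{n}(f_{1},\dots,f_{n}))=\check{P}(f_{1},\dots,f_{n})$ holds for all $f_{1},\dots,f_{n}\in E^+$, then $P$ is orthogonally additive.
   Context: $\mathbb{N}$ denotes the strictly positive integers. All vector spaces are real and all vector lattices are Archimedean. $E^+$ denotes the positive cone of $E$, and $f,g\in E$ are disjoint (written $f\perp g$) if $|f|\wedge|g|=0$. A map $P\colon E\to V$ is an $n$-homogeneous polynomial if there exists a (necessarily unique) symmetric $n$-linear map $\check{P}\colon E^n\to V$ such that $P(f)=\check{P}(f,\dots,f)$ for all $f\in E$. It is orthogonally additive if $P(f+g)=P(f)+P(g)$ holds whenever $f,g\in E$ are disjoint. For real numbers, the $n$th root mean power and the $n$th geometric mean are $$\mathfrak{S}_n(x_1,\dots,x_r)=\sqrt[n]{\sum_{k=1}^{r}x_k^n}\quad (x_1,\dots,x_r\in\mathbb{R}),\qquad \mathfrak{G}_{n}(x_1,\dots,x_n)=\sqrt[n]{\prod_{k=1}^{n}|x_k|}\quad (x_1,\dots,x_n\in\mathbb{R}).$$ For elements of the uniformly complete vector lattice $E$, $\mathfrak{S}_n(f_1,\dots,f_r)$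 and $\mathfrak{G}_n(f_1,\dots,f_n)$ are defined by the Archimedean vector lattice functional calculus: for a continuous positively homogeneous function $\omega\colon\mathbb{R}^s\to\mathbb{R}$ and $f_1,\dots,f_s\in E$, $\omega(f_1,\dots,f_s)$ is the unique element $g\in E$ such that $\phi(g)=\omega(\phi(f_1),\dots,\phi(f_s))$ for every real-valued vector lattice homomorphism $\phi$ on the vector sublattice of $E$ generated by $f_1,\dots,f_s,g$. Such a $g$ exists because $E$ is uniformly complete. *)

(* Defs.v *)
From HB Require Import structures.
From mathcomp Require Import all_boot all_order all_algebra.
From mathcomp Require Import perm.
From mathcomp Require Import all_classical all_reals all_analysis.

Set Implicit Arguments.
Unset Strict Implicit.
Unset Printing Implicit Defensive.

Import Order.TTheory GRing.Theory Num.Theory.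
Import numFieldNormedType.Exports.

Local Open Scope classical_set_scope.
Local Open Scope ring_scope.

(* The join and meet are fields rather than inherited from Order.Lattice, since
   the only structure joining Order.Lattice with GRing.Zmodule in the library's
   hierarchy is the totally ordered Num.RealDomain. *)
HB.mixin Record POrderedZmodule_isVectorLattice (R : realType) E
    of GRing.Lmodule R E & Num.POrderedZmodule E := {
  vjoin : E -> E -> E ;
  vmeet : E -> E -> E ;
  vleUx : forall x y z : E, (vjoin x y <= z) = (x <= z) && (y <= z) ;
  vlexI : forall x y z : E, (z <= vmeet x y) = (z <= x) && (z <= y) ;
  vleD2r : forall x y z : E, x <= y -> x + z <= y + z ;
  vscale_ge0 : forall (a : R) (x : E), 0 <= a -> 0 <= x -> 0 <= a *: x
}.

#[short(type="vectorLatticeType")]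
HB.structure Definition VectorLattice (R : realType) :=
  { E of POrderedZmodule_isVectorLattice R E & GRing.Lmodule R E
       & Num.POrderedZmodule E }.

Section VectorLattices.
Context {R : realType} {E : vectorLatticeType R}.

Definition vabs (x : E) : E := vjoin x (- x).
Definition disjoint (x y : E) : Prop := vmeet (vabs x) (vabs y) = 0.

Definition vector_sublattice : set (set E) :=
  [set L | [/\ L 0,
    (forall (a : R) x y, L x -> L y -> L (a *: x + y)),
    (forall x y, L x -> L y -> L (vjoin x y)) &
    (forall x y, L x -> L y -> L (vmeet x y))]].

Definition generated_sublattice (G : set E) : set E :=
  smallest vector_sublattice G.

(* The homomorphism has domain L: the values of phi outside L are junk. *)
Definition lattice_hom_on (L : set E) (phi : E -> R) : Prop :=
  [/\ forall (a : R) x y, L x -> L y -> phi (a *: x + y) = a * phi x + phi y,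
      forall x y, L x -> L y -> phi (vjoin x y) = Num.max (phi x) (phi y) &
      forall x y, L x -> L y -> phi (vmeet x y) = Num.min (phi x) (phi y)].

Definition is_fcalc (s : nat) (w : ('I_s -> R) -> R) (f : 'I_s -> E) (g : E) :
    Prop :=
  forall phi : E -> R,
    lattice_hom_on (generated_sublattice (range f `|` [set g])) phi ->
    phi g = w (phi \o f).

(* In a uniformly complete Archimedean vector lattice, and for w continuous and
   positively homogeneous, the element chosen here exists and is unique; the
   default value 0 is only returned when there is no such element. *)
Definition fcalc (s : nat) (w : ('I_s -> R) -> R) (f : 'I_s -> E) : E :=
  xget 0 [set g | is_fcalc w f g].

End VectorLattices.

Definition archimedean {R : realType} (E : vectorLatticeType R) : Prop :=
  forall x y : E, 0 <= x -> 0 <= y -> (forall k : nat, x *+ k <= y) -> x = 0.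

Definition uniformly_complete {R : realType} (E : vectorLatticeType R) : Prop :=
  forall (e : E) (u : nat -> E), 0 <= e ->
    (forall eps : R, 0 < eps -> exists N : nat, forall i j : nat,
      (N <= i)%N -> (N <= j)%N -> vabs (u i - u j) <= eps *: e) ->
    exists l : E, forall eps : R, 0 < eps -> exists N : nat, forall i : nat,
      (N <= i)%N -> vabs (u i - l) <= eps *: e.

Section Polynomials.
Context {R : realType}.

Definition multilinear {E V : lmodType R} (n : nat) (M : ('I_n -> E) -> V) :
    Prop :=
  forall (i : 'I_n) (f : 'I_n -> E) (a : R) (x y : E),
    M [eta f with i |-> a *: x + y] =
    a *: M [eta f with i |-> x] + M [eta f with i |-> y].

Definition symmetric_map {E V : Type} (n : nat) (M : ('I_n -> E) -> V) : Prop :=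
  forall (s : {perm 'I_n}) (f : 'I_n -> E), M (f \o s) = M f.

Definition homogeneous_polynomial_with {E V : lmodType R} (n : nat)
    (P : E -> V) (Pc : ('I_n -> E) -> V) : Prop :=
  [/\ symmetric_map Pc, multilinear Pc & forall f : E, P f = Pc (fun=> f)].

Definition orthogonally_additive {E : vectorLatticeType R} {V : lmodType R}
    (P : E -> V) : Prop :=
  forall f g : E, disjoint f g -> P (f + g) = P f + P g.

End Polynomials.

Section Means.
Context {R : realType}.

(* The real n-th root: the odd one when n is odd; for even n only its values at
   x >= 0 are meaningful. *)
Definition nthroot (n : nat) (x : R) : R := Num.sg x * `|x| `^ (n%:R^-1).

Definition root_mean_power (n r : nat) (x : 'I_r -> R) : R :=
  nthroot n (\sum_(k < r) x k ^+ n).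

Definition geometric_mean (n : nat) (x : 'I_n -> R) : R :=
  nthroot n (\prod_(k < n) `|x k|).

End Means.

(* Main.v *)
Require Import Defs.
From HB Require Import structures.
From mathcomp Require Import all_boot all_order all_algebra.
From mathcomp Require Import all_classical all_reals all_analysis.
From mathcomp Require Import ring lra.

(** A real lattice homomorphism [phi] sends disjoint positive elements [x], [y]
    to nonnegative reals at least one of which is zero. Hence, as seen by
    [phi], the root mean power of [x, y, 0, ..., 0] is [x + y], and the
    geometric mean of [x, x + y, ..., x + y] is [x]
    ([root_mean_power_disjoint], [geometric_mean_disjoint]). The first identity
    turns hypothesis (i) into [P (x + y) = P x + P y]. For (ii), write
    [P (x + y)] as the multilinear map at [(x + y, ..., x + y)] and split one
    single argument into [x] and [y]: by the second identity the two resulting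
    terms are [P x] and [P y].

    Turning what every [phi] sees into an equality in [E] requires that real
    homomorphisms on a finitely generated vector sublattice of an Archimedean
    vector lattice separate points ([exists_separating_hom]). Let [e] dominate
    the generators in absolute value. The gauge [inf {t | x <= t e}] is, in the
    Yosida picture, the maximum of [x] over the spectrum: it is sublinear and
    turns joins into maxima. Such a functional can be decreased so as to become
    linear along a prescribed [x] while keeping these properties
    ([max_sublinear_tilt]); for the maximum over a compact set this is the
    restriction to the points where [x] is maximal. The vectors along which it
    is linear form a vector sublattice on which it is a lattice homomorphism
    ([linear_part_hom]), so after treating the finitely many generators one by
    one it is a homomorphism on all they generate. The Archimedean property
    makes the gauge of a positive nonzero [u] positive, and tilting along [u]
    first keeps the value at [u] positive.

    It remains to pass from disjoint positive elements to arbitrary disjoint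
    ones ([orthogonally_additive_of_positive]). Along a line, [P] is a
    polynomial in the real parameter with coefficients in [V]; an additivity
    relation that holds for positive parameters therefore holds at [-1], which
    introduces the signs needed to treat positive and negative parts. *)

Set Implicit Arguments.
Unset Strict Implicit.
Unset Printing Implicit Defensive.

Import Order.TTheory GRing.Theory Num.Theory.
Local Open Scope ring_scope.

(** * Order, lattice operations and disjointness in a vector lattice *)

Section VectorLatticeTheory.
Context {R : realType} {E : vectorLatticeType R}.
Implicit Types (x y z e : E) (a b t : R).

Lemma vleD2 x y z : (x + z <= y + z) = (x <= y).
Proof.
apply/idP/idP; last exact: vleD2r.
by move=> h; have := vleD2r _ _ (- z) h; rewrite !addrK.
Qed.

Lemma vleD x y z w : x <= y -> z <= w -> x + z <= y + w.
Proof.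
move=> xy zw; apply: le_trans (vleD2r _ _ z xy) _.
by rewrite ![y + _]addrC vleD2.
Qed.

Lemma vleBlDr x y z : (x - y <= z) = (x <= z + y).
Proof. by rewrite -(vleD2 (x - y) z y) subrK. Qed.

Lemma vsub_ge0 x y : (0 <= y - x) = (x <= y).
Proof. by rewrite -(vleD2 0 _ x) add0r subrK. Qed.

Lemma vleN x y : (- x <= - y) = (y <= x).
Proof. by rewrite -(vleD2 (- x) _ (x + y)) addKr [x + y]addrC addKr. Qed.

Lemma vscale_le a x y : 0 <= a -> x <= y -> a *: x <= a *: y.
Proof.
by move=> a0 xy; rewrite -vsub_ge0 -scalerBr vscale_ge0 ?vsub_ge0.
Qed.

Lemma vscale_le_l a b e : 0 <= e -> a <= b -> a *: e <= b *: e.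
Proof.
by move=> e0 ab; rewrite -vsub_ge0 -scalerBl vscale_ge0 ?subr_ge0.
Qed.

Lemma vle_joinl x y : x <= vjoin x y.
Proof. by have := vleUx x y (vjoin x y); rewrite lexx => /esym/andP[]. Qed.

Lemma vle_joinr x y : y <= vjoin x y.
Proof. by have := vleUx x y (vjoin x y); rewrite lexx => /esym/andP[]. Qed.

Lemma vmeet_lel x y : vmeet x y <= x.
Proof. by have := vlexI x y (vmeet x y); rewrite lexx => /esym/andP[]. Qed.

Lemma vmeet_ler x y : vmeet x y <= y.
Proof. by have := vlexI x y (vmeet x y); rewrite lexx => /esym/andP[]. Qed.

Lemma vjoinDr x y z : vjoin x y + z = vjoin (x + z) (y + z).
Proof.
apply: le_anti; apply/andP; split.
  by rewrite -{1}(opprK z) vleBlDr vleUx -(vleD2 x _ z) -(vleD2 y _ z) !subrK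
     vle_joinl vle_joinr.
by rewrite vleUx !vleD2 vle_joinl vle_joinr.
Qed.

Lemma vmeetN x y : vmeet x y = - vjoin (- x) (- y).
Proof.
apply: le_anti; apply/andP; split.
  by rewrite -vleN opprK vleUx !vleN vmeet_lel vmeet_ler.
by rewrite vlexI -(vleN x) -(vleN y) !opprK vle_joinl vle_joinr.
Qed.

Lemma vabs_ge0 x : 0 <= vabs x.
Proof.
have h : 0 <= vabs x + vabs x.
  by rewrite -(subrr x); apply: vleD; [exact: vle_joinl|exact: vle_joinr].
have : (2^-1 : R) *: 0 <= 2^-1 *: (vabs x + vabs x).
  by apply: vscale_le; rewrite ?invr_ge0.
have half : 2^-1 + 2^-1 = 1 :> R by lra.
by rewrite scaler0 scalerDr -scalerDl half scale1r.
Qed.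

Lemma vabs_eq0 x : vabs x = 0 -> x = 0.
Proof.
move=> h; apply: le_anti; rewrite -{1}h vle_joinl /=.
by rewrite -vleN oppr0 -h vle_joinr.
Qed.

Definition positive_disjoint x y : Prop := [/\ 0 <= x, 0 <= y & vmeet x y = 0].

Lemma positive_disjointP x y : 0 <= x -> 0 <= y ->
  (forall z, z <= x -> z <= y -> z <= 0) -> positive_disjoint x y.
Proof.
move=> x0 y0 h; split=> //; apply: le_anti.
by rewrite vlexI x0 y0 h ?vmeet_lel ?vmeet_ler.
Qed.

Lemma positive_disjoint_le0 x y z :
  positive_disjoint x y -> z <= x -> z <= y -> z <= 0.
Proof. by case=> _ _ <- zx zy; rewrite vlexI zx zy. Qed.

Lemma positive_disjointC x y : positive_disjoint x y -> positive_disjoint y x.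
Proof.
move=> d; have [x0 y0 _] := d; apply: positive_disjointP => // z zy zx.
exact: positive_disjoint_le0 d zx zy.
Qed.

Lemma positive_disjoint_sub x y x' y' : positive_disjoint x y ->
  0 <= x' <= x -> 0 <= y' <= y -> positive_disjoint x' y'.
Proof.
move=> d /andP[x0 xx] /andP[y0 yy]; apply: positive_disjointP => // z zx zy.
by apply: positive_disjoint_le0 d _ _;
  [exact: le_trans zx xx|exact: le_trans zy yy].
Qed.

(** A lower bound [w] of [x + y] and [z] satisfies [w - y <= x] and
    [w - y <= z], hence [w <= y] by disjointness of [x] and [z], and then
    [w <= 0] by that of [y] and [z]. *)
Lemma positive_disjointD x y z : positive_disjoint x z ->
  positive_disjoint y z -> positive_disjoint (x + y) z.
Proof.
move=> dx dy; have [x0 z0 _] := dx; have [y0 _ _] := dy.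
apply: positive_disjointP => // [|w wxy wz].
  by rewrite -[0]addr0 vleD.
apply: (positive_disjoint_le0 dy) => //; rewrite -(add0r y) -vleBlDr.
apply: (positive_disjoint_le0 dx); first by rewrite vleBlDr.
by apply: le_trans wz; rewrite vleBlDr -{1}(addr0 w) vleD.
Qed.

(** Both [x] and [t y] lie below the multiples by [1 + t], and dilations
    preserve disjointness. *)
Lemma positive_disjointZ t x y : 0 <= t -> positive_disjoint x y ->
  positive_disjoint x (t *: y).
Proof.
move=> t0 d; have [x0 y0 _] := d.
apply: positive_disjointP => // [|z zx zy]; first exact: vscale_ge0.
have c0 : 0 < 1 + t by lra.
suff : (1 + t)^-1 *: z <= 0.
  move=> /(vscale_le (ltW c0)).
  by rewrite scaler0 scalerA mulfV ?gt_eqF// scale1r.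
have ci : 0 <= (1 + t)^-1 by rewrite invr_ge0 ltW.
apply: (positive_disjoint_le0 d).
- have -> : x = (1 + t)^-1 *: ((1 + t) *: x).
    by rewrite scalerA mulVf ?gt_eqF// scale1r.
  apply: vscale_le => //; apply: le_trans zx _.
  by rewrite -{1}(scale1r x) vscale_le_l//; lra.
- have -> : y = (1 + t)^-1 *: ((1 + t) *: y).
    by rewrite scalerA mulVf ?gt_eqF// scale1r.
  apply: vscale_le => //; apply: le_trans zy _.
  by rewrite vscale_le_l//; lra.
Qed.

Definition vpos x : E := vjoin x 0.

Lemma vpos_ge0 x : 0 <= vpos x.
Proof. exact: vle_joinr. Qed.

Lemma vpos_subN x : vpos x - vpos (- x) = x.
Proof.
apply/eqP; rewrite subr_eq addrC /vpos vjoinDr addNr add0r.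
by apply/eqP/le_anti; rewrite !vleUx !vle_joinl !vle_joinr.
Qed.

(** From [z <= x^+] and [z <= x^- = x^+ - x] follow [0 <= x^+ - z] and
    [x <= x^+ - z], that is [x^+ <= x^+ - z]. *)
Lemma vpos_disjoint x : positive_disjoint (vpos x) (vpos (- x)).
Proof.
apply: positive_disjointP => [||z zx]; try exact: vpos_ge0.
have -> : vpos (- x) = vpos x - x.
  by rewrite -[in X in _ - X](vpos_subN x) subKr.
move=> zNx; have : vpos x <= vpos x - z.
  rewrite {1}/vpos vleUx vsub_ge0 zx andbT.
  by rewrite -(vleD2 _ _ z) subrK addrC -(vleD2 _ _ (- x)) addrK.
by rewrite -vsub_ge0 addrAC subrr add0r -{1}oppr0 vleN.
Qed.

Lemma vpos_le_vabs x : vpos x <= vabs x.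
Proof. by rewrite vleUx vle_joinl vabs_ge0. Qed.

Lemma disjoint_vpos x y : Defs.disjoint x y ->
  positive_disjoint (vpos x) (vpos y).
Proof.
move=> xy; have d : positive_disjoint (vabs x) (vabs y).
  by split; rewrite ?vabs_ge0.
by apply: positive_disjoint_sub d _ _; rewrite vpos_ge0 vpos_le_vabs.
Qed.

Lemma vabsN x : vabs (- x) = vabs x.
Proof.
by rewrite /vabs opprK; apply: le_anti; rewrite !vleUx !vle_joinl !vle_joinr.
Qed.

Lemma disjointNl x y : Defs.disjoint x y -> Defs.disjoint (- x) y.
Proof. by rewrite /Defs.disjoint vabsN. Qed.

Lemma disjointNr x y : Defs.disjoint x y -> Defs.disjoint x (- y).
Proof. by rewrite /Defs.disjoint vabsN. Qed.

Lemma disjointN x y : Defs.disjoint x y -> Defs.disjoint (- x) (- y).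
Proof. by move=> xy; exact/disjointNl/disjointNr. Qed.

End VectorLatticeTheory.

(** * Real lattice homomorphisms separate points *)

Section LatticeHomomorphisms.
Context {R : realType} {E : vectorLatticeType R}.
Implicit Types (x y z e : E) (a b t : R) (I L : set E) (p q phi : E -> R).
Local Open Scope classical_set_scope.

(** Abstract form of the functionals [x |-> max of x over K], for [K] a
    nonempty compact set of real lattice homomorphisms on [I]. *)
Definition max_sublinear I p : Prop :=
  [/\ forall x y, I x -> I y -> x <= y -> p x <= p y,
      forall t x, I x -> 0 <= t -> p (t *: x) = t * p x,
      forall x y, I x -> I y -> p (x + y) <= p x + p y &
      forall x y, I x -> I y -> p (vjoin x y) <= Num.max (p x) (p y)].

Lemma sublatticeZ I a x : vector_sublattice I -> I x -> I (a *: x).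
Proof. by case=> I0 IL _ _ Ix; rewrite -[_ *: _]addr0; exact: IL. Qed.

Lemma sublatticeN I x : vector_sublattice I -> I x -> I (- x).
Proof. by move=> hI Ix; rewrite -scaleN1r; exact: sublatticeZ. Qed.

Lemma sublatticeD I x y : vector_sublattice I -> I x -> I y -> I (x + y).
Proof. by case=> _ IL _ _ Ix Iy; rewrite -(scale1r x); exact: IL. Qed.

Lemma max_sublinear0 I p : vector_sublattice I -> max_sublinear I p -> p 0 = 0.
Proof. by move=> [I0 _ _ _] [_ pZ _ _]; rewrite -(scale0r 0) pZ// mul0r. Qed.

Lemma max_sublinearN_ge I p x : vector_sublattice I -> max_sublinear I p ->
  I x -> - p (- x) <= p x.
Proof.
move=> hI hp Ix; have [_ _ pD _] := hp.
have := pD _ _ Ix (sublatticeN hI Ix).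
by rewrite subrr (max_sublinear0 hI hp) => ?; lra.
Qed.

(** The one-sided derivative of the sublinear [p] at the point [x] in direction
    [y]. When [p] is the maximum over a compact set, this is the maximum over
    the subset on which [x] attains its maximum. *)
Definition tilt p x y : R :=
  inf [set c | exists2 s : R, 0 <= s & c = p (y + s *: x) - s * p x].

Section Tilt.
Variables (I : set E) (p : E -> R) (x : E).
Hypotheses (hI : vector_sublattice I) (hp : max_sublinear I p) (Ix : I x).

Let pI y s : I y -> I (y + s *: x).
Proof. by move=> Iy; apply: sublatticeD => //; exact: sublatticeZ. Qed.

Lemma tilt_le y s : I y -> 0 <= s -> tilt p x y <= p (y + s *: x) - s * p x.
Proof.
move=> Iy s0; apply: ge_inf; last by exists s.
exists (- p (- y)) => _ [t t0 ->]; have [_ pZ pD _] := hp.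
have := pD _ _ (pI t Iy) (sublatticeN hI Iy).
by rewrite addrAC subrr add0r pZ// => ?; lra.
Qed.

Lemma tilt_lt y b : tilt p x y < b ->
  exists2 s : R, 0 <= s & p (y + s *: x) - s * p x < b.
Proof.
move=> /inf_lt h; case: h => [|_ [s s0 ->] ?]; last by exists s.
by exists (p (y + 0 *: x) - 0 * p x); exists 0.
Qed.

Lemma tilt_le_self y : I y -> tilt p x y <= p y.
Proof.
move=> Iy; apply: le_trans (tilt_le Iy (lexx 0)) _.
by rewrite scale0r addr0 mul0r subr0.
Qed.

Lemma tiltN_le : tilt p x (- x) <= - p x.
Proof.
apply: le_trans (tilt_le (sublatticeN hI Ix) ler01) _.
by rewrite scale1r addNr (max_sublinear0 hI hp) mul1r sub0r.
Qed.

(** Subadditivity of [p] makes the expression whose infimum defines [tilt]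
    monotone in the parameter. This is what lets the infimum commute with the
    binary maximum in [max_sublinear_tilt]: two near-optimal parameters can be
    replaced by the larger one. *)
Lemma tilt_slope_nonincreasing y (s s' : R) : I y -> 0 <= s <= s' ->
  p (y + s' *: x) - s' * p x <= p (y + s *: x) - s * p x.
Proof.
move=> Iy /andP[s0 ss]; have [_ pZ pD _] := hp.
have -> : y + s' *: x = y + s *: x + (s' - s) *: x.
  by rewrite -addrA -scalerDl addrCA subrr addr0.
have := pD _ _ (pI s Iy) (sublatticeZ (s' - s) hI Ix).
by rewrite pZ ?subr_ge0// => h; lra.
Qed.

(** Near-optimal parameters for [y] and [z] are added for the subadditivity and
    replaced by the larger one for the join. Staying in the same class is what
    allows tilting along one vector after another. *)
Lemma max_sublinear_tilt : max_sublinear I (tilt p x).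
Proof.
have [pmono pZ pD pU] := hp; have [I0 _ IU _] := hI.
have tmono y z : I y -> I z -> y <= z -> tilt p x y <= tilt p x z.
  move=> Iy Iz yz; rewrite leNgt; apply/negP => /tilt_lt[s s0].
  have := tilt_le Iy s0.
  have := pmono _ _ (pI s Iy) (pI s Iz).
  by rewrite vleD2 yz => /(_ isT); lra.
have tZ t y : 0 < t -> I y -> tilt p x (t *: y) <= t * tilt p x y.
  move=> t0 Iy; rewrite -ler_pdivrMl// leNgt; apply/negP => /tilt_lt[s s0].
  rewrite ltr_pdivlMl//.
  have := tilt_le (sublatticeZ t hI Iy) (mulr_ge0 (ltW t0) s0).
  by rewrite -scalerA -scalerDr pZ; [lra|exact: pI|exact: ltW].
split=> //.
- move=> t y Iy; rewrite le_eqVlt => /orP[/eqP<-|t0].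
    rewrite scale0r mul0r; apply: le_anti; rewrite -{1}(max_sublinear0 hI hp).
    rewrite tilt_le_self//= leNgt; apply/negP => /tilt_lt[s s0].
    by rewrite add0r pZ// subrr ltxx.
  apply: le_anti; rewrite tZ//= -ler_pdivlMl//.
  have ti : 0 < t^-1 by rewrite invr_gt0.
  have := tZ _ _ ti (sublatticeZ t hI Iy).
  by rewrite scalerA mulVf ?gt_eqF// scale1r.
- move=> y z Iy Iz; rewrite -lerBlDr leNgt; apply/negP => /tilt_lt[s s0].
  rewrite ltrBrDr addrC -ltrBrDr => /tilt_lt[s' s'0].
  have := tilt_le (sublatticeD hI Iy Iz) (addr_ge0 s0 s'0).
  rewrite scalerDl addrACA.
  have := pD _ _ (pI s Iy) (pI s' Iz); lra.
- move=> y z Iy Iz; rewrite leNgt; apply/negP.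
  rewrite gt_max => /andP[/tilt_lt[s s0 hs] /tilt_lt[s' s'0 hs']].
  set m := Num.max s s'; have m0 : 0 <= m by rewrite le_max s0.
  have := tilt_le (IU _ _ Iy Iz) m0; rewrite vjoinDr.
  have hy : p (y + m *: x) - m * p x < tilt p x (vjoin y z).
    apply: le_lt_trans hs; apply: tilt_slope_nonincreasing => //.
    by rewrite s0 le_max lexx.
  have hz : p (z + m *: x) - m * p x < tilt p x (vjoin y z).
    apply: le_lt_trans hs'; apply: tilt_slope_nonincreasing => //.
    by rewrite s'0 le_max lexx orbT.
  have := pU _ _ (pI m Iy) (pI m Iz); rewrite le_max => /orP[]; lra.
Qed.

End Tilt.

(** Tilting along each element of the list in turn works because linearity along
    a vector is never lost when the functional decreases: [q x + q (- x)] is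
    nonnegative for every sublinear [q], so it stays zero. *)
Lemma max_sublinear_linearize I p (s : seq E) : vector_sublattice I ->
  max_sublinear I p -> (forall x, x \in s -> I x) ->
  exists q, [/\ max_sublinear I q, forall x, I x -> q x <= p x &
    forall x, x \in s -> q (- x) = - q x].
Proof.
move=> hI; elim: s p => [|x s IH] p hp Is; first by exists p.
have Ix : I x by apply: Is; rewrite mem_head.
have [|q [hq qp ql]] := IH _ (max_sublinear_tilt hI hp Ix).
  by move=> y ys; apply: Is; rewrite inE ys orbT.
exists q; split=> // [y Iy|y].
  exact: le_trans (qp _ Iy) (tilt_le_self hI hp Ix Iy).
rewrite inE => /orP[/eqP ->|]; last exact: ql.
have h1 := qp _ (sublatticeN hI Ix).
have h2 := tiltN_le hI hp Ix.
have h3 := max_sublinearN_ge hI hq Ix.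
have h4 := qp _ Ix; have h5 := tilt_le_self hI hp Ix Ix.
lra.
Qed.

Definition linear_part I p : set E := [set x | I x /\ p (- x) = - p x].

Section LinearPart.
Variables (I : set E) (p : E -> R).
Hypotheses (hI : vector_sublattice I) (hp : max_sublinear I p).

Lemma linear_partP x : I x -> p (- x) <= - p x -> linear_part I p x.
Proof.
move=> Ix h; split=> //; apply: le_anti; rewrite h /=.
by have := max_sublinearN_ge hI hp Ix; rewrite lerNl.
Qed.

Lemma linear_partN x : linear_part I p x -> linear_part I p (- x).
Proof.
by case=> Ix xl; split; [exact: sublatticeN|rewrite xl !opprK].
Qed.

Lemma linear_partZ a x : linear_part I p x ->
  linear_part I p (a *: x) /\ p (a *: x) = a * p x.
Proof.
have [_ pZ _ _] := hp.
have pos b y : 0 <= b -> linear_part I p y ->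
    linear_part I p (b *: y) /\ p (b *: y) = b * p y.
  move=> b0 [Iy yl]; rewrite !pZ//; split=> //.
  split; first exact: sublatticeZ.
  by rewrite -scalerN !pZ// ?yl ?mulrN//; exact: sublatticeN.
move=> hx; have [|/ltW a0] := leP 0 a; first by move/pos; apply.
rewrite -(opprK x) scalerN -scaleNr.
have [|h1 h2] := pos (- a) _ _ (linear_partN hx); first by rewrite oppr_ge0.
split=> //; rewrite h2; case: (linear_partN hx) => _ ->; ring.
Qed.

Lemma linear_partD x y : linear_part I p x -> linear_part I p y ->
  linear_part I p (x + y) /\ p (x + y) = p x + p y.
Proof.
move=> [Ix xl] [Iy yl]; have [_ _ pD _] := hp.
have Ixy := sublatticeD hI Ix Iy.
have h1 := pD _ _ Ix Iy.
have h2 := pD _ _ (sublatticeN hI Ix) (sublatticeN hI Iy).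
have h3 := max_sublinearN_ge hI hp Ixy.
by rewrite -opprD in h2; split; [apply: linear_partP => //|]; lra.
Qed.

(** The lower bound on [p] of the join comes from monotonicity, and so does
    [p (- vjoin x y) <= min (- p x) (- p y)], which is linearity along the
    join. *)
Lemma linear_partU x y : linear_part I p x -> linear_part I p y ->
  linear_part I p (vjoin x y) /\ p (vjoin x y) = Num.max (p x) (p y).
Proof.
move=> [Ix xl] [Iy yl]; have [pmono _ _ pU] := hp; have [_ _ IU _] := hI.
have Ixy := IU _ _ Ix Iy.
have e : p (vjoin x y) = Num.max (p x) (p y).
  apply: le_anti; rewrite pU//= ge_max.
  by rewrite !pmono ?vle_joinl ?vle_joinr.
split=> //; apply: linear_partP => //; rewrite e lerNr ge_max.
rewrite (lerNr (p x)) (lerNr (p y)) -xl -yl.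
by rewrite !pmono ?vleN ?vle_joinl ?vle_joinr//; exact: sublatticeN.
Qed.

Lemma linear_part_hom : vector_sublattice (linear_part I p) /\
  lattice_hom_on (linear_part I p) p.
Proof.
have meet x y : linear_part I p x -> linear_part I p y ->
    linear_part I p (vmeet x y) /\ p (vmeet x y) = Num.min (p x) (p y).
  move=> hx hy; rewrite vmeetN.
  have [h1 h2] := linear_partU (linear_partN hx) (linear_partN hy).
  split; first exact: linear_partN.
  case: h1 => _ ->; rewrite h2; case: hx => _ ->; case: hy => _ ->.
  by rewrite -oppr_min opprK.
split; split.
- by split; [case: hI|rewrite oppr0 (max_sublinear0 hI hp) oppr0].
- by move=> a x y /(linear_partZ a)[h _] hy; case: (linear_partD h hy).
- by move=> x y hx hy; case: (linear_partU hx hy).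
- by move=> x y hx hy; case: (meet _ _ hx hy).
- by move=> a x y /(linear_partZ a)[h <-] hy; case: (linear_partD h hy).
- by move=> x y hx hy; case: (linear_partU hx hy).
- by move=> x y hx hy; case: (meet _ _ hx hy).
Qed.

End LinearPart.

Definition principal_ideal e : set E :=
  [set x | exists k : R, x <= k *: e /\ - x <= k *: e].

Lemma principal_ideal_sublattice e : 0 <= e ->
  vector_sublattice (principal_ideal e).
Proof.
move=> e0.
have idealN x : principal_ideal e x -> principal_ideal e (- x).
  by case=> k [h1 h2]; exists k; rewrite opprK.
have idealZ a x : 0 <= a -> principal_ideal e x -> principal_ideal e (a *: x).
  move=> a0 [k [h1 h2]]; exists (a * k).
  by rewrite -scalerA -scalerN !vscale_le.
have idealU x y : principal_ideal e x -> principal_ideal e y ->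
    principal_ideal e (vjoin x y).
  move=> [k [h1 h2]] [l [h3 h4]]; exists (Num.max k l).
  rewrite vleUx; split.
    by rewrite (le_trans h1) ?(le_trans h3)// vscale_le_l// le_max lexx ?orbT.
  apply: (@le_trans _ _ (- x)); first by rewrite vleN vle_joinl.
  by rewrite (le_trans h2)// vscale_le_l// le_max lexx.
split=> //.
- by exists 0; rewrite oppr0 scale0r.
- move=> a x y hx [l [h3 h4]].
  have [k [h1 h2]] : principal_ideal e (a *: x).
    have [a0|/ltW a0] := leP 0 a; first exact: idealZ.
    rewrite -(opprK x) scalerN -scaleNr; apply: idealZ; last exact: idealN.
    by rewrite oppr_ge0.
  by exists (k + l); rewrite opprD scalerDl !vleD.
- move=> x y hx hy; rewrite vmeetN; apply/idealN/idealU; exact: idealN.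
Qed.

Definition upper_gauge e x : R := inf [set t : R | x <= t *: e].

Section UpperGauge.
Variable e : E.
Hypotheses (e0 : 0 <= e) (e_neq0 : e != 0).

Lemma scale_unit_ge0 t : 0 <= t *: e -> 0 <= t.
Proof.
move=> h; rewrite leNgt; apply/negP => t0; move/eqP: e_neq0; apply.
apply: le_anti; rewrite e0 andbT.
have : (- t^-1) *: 0 <= (- t^-1) *: (t *: e).
  by apply: vscale_le => //; rewrite oppr_ge0 invr_le0 ltW.
by rewrite scaler0 scalerA mulNr mulVf ?lt_eqF// scaleN1r -vleN opprK oppr0.
Qed.

Lemma upper_gauge_le x t : principal_ideal e x -> x <= t *: e ->
  upper_gauge e x <= t.
Proof.
move=> [k [_ h]] xt; apply: ge_inf => //.
exists (- k) => b /= xb; rewrite -subr_ge0 opprK.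
apply: scale_unit_ge0; rewrite scalerDl -(subrr x); exact: vleD.
Qed.

Lemma upper_gauge_lt x b : principal_ideal e x -> upper_gauge e x < b ->
  exists2 t, x <= t *: e & t < b.
Proof. by move=> [k [h _]]; apply: inf_lt; exists k. Qed.

Lemma max_sublinear_upper_gauge :
  max_sublinear (principal_ideal e) (upper_gauge e).
Proof.
have hI := principal_ideal_sublattice e0; have [I0 _ IU _] := hI.
have g0 : upper_gauge e 0 = 0.
  apply: le_anti; rewrite upper_gauge_le ?scale0r//=.
  apply: lb_le_inf; first by exists 0; rewrite /= scale0r.
  by move=> t /= /scale_unit_ge0.
have gZ t x : 0 < t -> principal_ideal e x ->
    upper_gauge e (t *: x) <= t * upper_gauge e x.
  move=> t0 Ix; rewrite -ler_pdivrMl// leNgt; apply/negP.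
  move=> /(upper_gauge_lt Ix)[c xc].
  rewrite ltr_pdivlMl// ltNge => /negP; apply.
  apply: upper_gauge_le; first exact: sublatticeZ.
  by rewrite -scalerA vscale_le// ltW.
split=> //.
- move=> x y Ix Iy xy; rewrite leNgt; apply/negP.
  move=> /(upper_gauge_lt Iy)[c yc]; rewrite ltNge => /negP; apply.
  by apply: upper_gauge_le => //; exact: le_trans xy yc.
- move=> t x Ix; rewrite le_eqVlt => /orP[/eqP<-|t0].
    by rewrite scale0r mul0r g0.
  apply: le_anti; rewrite gZ//= -ler_pdivlMl//.
  have ti : 0 < t^-1 by rewrite invr_gt0.
  have := gZ _ _ ti (sublatticeZ t hI Ix).
  by rewrite scalerA mulVf ?gt_eqF// scale1r.
- move=> x y Ix Iy; rewrite -lerBlDr leNgt; apply/negP.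
  move=> /(upper_gauge_lt Ix)[c xc]; rewrite ltrBrDr addrC -ltrBrDr.
  move=> /(upper_gauge_lt Iy)[d yd].
  rewrite ltrBrDr addrC ltNge => /negP; apply.
  apply: upper_gauge_le; first exact: sublatticeD.
  by rewrite scalerDl vleD.
- move=> x y Ix Iy; rewrite leNgt; apply/negP; rewrite gt_max => /andP[].
  move=> /(upper_gauge_lt Ix)[c xc cm] /(upper_gauge_lt Iy)[d yd dm].
  have xyt : vjoin x y <= Num.max c d *: e.
    rewrite vleUx; apply/andP; split.
      by apply: le_trans xc _; rewrite vscale_le_l// le_max lexx.
    by apply: le_trans yd _; rewrite vscale_le_l// le_max lexx orbT.
  have := upper_gauge_le (IU _ _ Ix Iy) xyt.
  by rewrite leNgt gt_max cm dm.
Qed.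

Lemma upper_gauge_gt0 x : archimedean E -> 0 <= x -> x != 0 ->
  principal_ideal e x -> 0 < upper_gauge e x.
Proof.
move=> arch x0 xn0 Ix; rewrite ltNge; apply/negP => gx.
move/eqP: xn0; apply; apply: (arch x e) => // k.
have [->|k0] := posnP k; first by rewrite mulr0n.
have kR : 0 < k%:R :> R by rewrite ltr0n.
have [|c xc ck] := upper_gauge_lt (b := k%:R^-1) Ix.
  by rewrite (le_lt_trans gx)// invr_gt0.
rewrite -scaler_nat.
have : (k%:R : R) *: x <= k%:R *: (k%:R^-1 *: e).
  apply: vscale_le; first exact: ltW.
  by apply: le_trans xc _; apply: vscale_le_l => //; exact: ltW.
by rewrite scalerA mulfV ?gt_eqF// scale1r.
Qed.

End UpperGauge.

Lemma lattice_hom_on_sub L L' phi : L `<=` L' ->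
  lattice_hom_on L' phi -> lattice_hom_on L phi.
Proof.
move=> LL [h1 h2 h3]; split=> *; [apply: h1|apply: h2|apply: h3]; exact: LL.
Qed.

Lemma lattice_hom_on0 L phi x : lattice_hom_on L phi -> L x -> phi 0 = 0.
Proof.
move=> [hL _ _] Lx.
by have := hL (-1) _ _ Lx Lx; rewrite scaleN1r addNr => ->; ring.
Qed.

Lemma lattice_hom_on_disjoint L phi x y :
  lattice_hom_on L phi -> L x -> L y -> positive_disjoint x y ->
  [/\ 0 <= phi x, 0 <= phi y, phi x * phi y = 0 & phi (x + y) = phi x + phi y].
Proof.
move=> hom Lx Ly [_ _ xy0]; have [hL _ hI] := hom.
have := hI _ _ Lx Ly; rewrite xy0 (lattice_hom_on0 hom Lx) => hmin.
have hx : 0 <= phi x by rewrite hmin ge_min lexx.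
have hy : 0 <= phi y by rewrite hmin ge_min lexx orbT.
split=> //; last by have := hL 1 _ _ Lx Ly; rewrite scale1r mul1r.
by move: hmin; case: leP => _ <-; rewrite ?mul0r ?mulr0.
Qed.

Lemma generated_sublattice_gen (G : set E) : G `<=` generated_sublattice G.
Proof. exact: sub_gen_smallest. Qed.

Lemma generated_sublatticeP (G : set E) :
  vector_sublattice (generated_sublattice G).
Proof.
split=> [M [[]]//|a x y Gx Gy M hM|x y Gx Gy M hM|x y Gx Gy M hM].
- by case: (hM) => -[_ h _ _] _; apply: h; [exact: Gx|exact: Gy].
- by case: (hM) => -[_ _ h _] _; apply: h; [exact: Gx|exact: Gy].
- by case: (hM) => -[_ _ _ h] _; apply: h; [exact: Gx|exact: Gy].
Qed.

Lemma generated_sublatticeS (G H : set E) : G `<=` H ->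
  generated_sublattice G `<=` generated_sublattice H.
Proof. by move=> GH x Gx M [hM HM]; apply: Gx; split=> // y /GH /HM. Qed.

(** The gauge of the sum of the absolute values is first tilted along [u], so
    that its value at [- u] drops to minus the gauge of [u], a negative number.
    Linearizing along the generators can only decrease that value. *)
Lemma exists_separating_hom (s : seq E) u : archimedean E ->
  u \in s -> 0 <= u -> u != 0 ->
  exists2 phi, lattice_hom_on (generated_sublattice [set` s]) phi & phi u != 0.
Proof.
move=> arch us u0 un0; pose e := \sum_(x <- s) vabs x.
have le_e x : x \in s -> vabs x <= e.
  rewrite /e; elim: s {us e} => // y s IH; rewrite inE big_cons.
  have s0 : 0 <= \sum_(x <- s) vabs x.
    elim: s {IH} => [|z s IH]; first by rewrite big_nil.
    by rewrite big_cons -{1}[0]addr0 vleD ?vabs_ge0.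
  move=> /orP[/eqP <-|xs].
    by rewrite -{1}[vabs x]addr0 vleD.
  by rewrite -[vabs x]add0r vleD ?vabs_ge0 ?IH.
have e0 : 0 <= e := le_trans (vabs_ge0 u) (le_e _ us).
have Is x : x \in s -> principal_ideal e x.
  move=> /le_e xe; exists 1; rewrite scale1r; split; apply: le_trans xe.
    exact: vle_joinl.
  exact: vle_joinr.
have en0 : e != 0.
  apply: contra un0 => /eqP e00; apply/eqP/vabs_eq0.
  by apply: le_anti; rewrite vabs_ge0 andbT -e00 le_e.
have hI := principal_ideal_sublattice e0; have Iu := Is _ us.
have hp := max_sublinear_upper_gauge e0 en0.
have [q [hq qp ql]] :=
  max_sublinear_linearize hI (max_sublinear_tilt hI hp Iu) Is.
have [linI hom] := linear_part_hom hI hq.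
exists q.
  apply: lattice_hom_on_sub hom; apply: smallest_sub => // x xs.
  by split; [exact: Is|exact: ql].
have h1 := qp _ (sublatticeN hI Iu).
have h2 := tiltN_le hI hp Iu.
have h3 := upper_gauge_gt0 e0 arch u0 un0 Iu.
have h4 := ql _ us.
by rewrite gt_eqF//; lra.
Qed.

(** A homomorphism is needed on one sublattice that contains both candidates,
    since each of them is tested only on the sublattice that it generates with
    [f]; restricting to the two smaller sublattices gives the same value. The
    element [vabs (g - h)] joins the generators to serve as the separated
    element. *)
Lemma is_fcalc_unique (n : nat) (w : ('I_n -> R) -> R) (f : 'I_n -> E)
    (g h : E) : archimedean E -> is_fcalc w f g -> is_fcalc w f h -> g = h.
Proof.
move=> arch hg hh; apply/eqP; rewrite -subr_eq0; apply/negPn/negP => d0.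
pose u := vabs (g - h).
have un0 : u != 0 by apply: contra d0 => /eqP/vabs_eq0 ->.
pose s := [:: u, g, h & codom f].
have [||phi hom] := @exists_separating_hom s u arch _ _ un0.
- exact: mem_head.
- exact: vabs_ge0.
pose L := generated_sublattice [set` s].
have Lgen x : x \in s -> L x by move=> xs; exact: generated_sublattice_gen.
have fcalc_phi k : k \in s -> is_fcalc w f k -> phi k = w (phi \o f).
  move=> ks; apply; apply: lattice_hom_on_sub hom; apply: generated_sublatticeS.
  move=> x [[i _ <-]|->] //=.
  by rewrite !inE codom_f !orbT.
have Lg : L g by apply: Lgen; rewrite !inE eqxx !orbT.
have Lh : L h by apply: Lgen; rewrite !inE eqxx !orbT.
have phigh : phi g = phi h.
  by rewrite !fcalc_phi//; rewrite !inE eqxx !orbT.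
have [hL hU _] := hom.
have [L0 LL _ _] := generated_sublatticeP [set` s].
have phi0 := lattice_hom_on0 hom Lg.
have phid : phi (g - h) = 0.
  by rewrite addrC -scaleN1r hL// phigh; ring.
have Ld : L (g - h) by rewrite addrC -scaleN1r; exact: LL.
have phiNd : phi (- (g - h)) = 0.
  by rewrite -scaleN1r -[_ *: _]addr0 hL// phid phi0; ring.
have LNd : L (- (g - h)) by rewrite -scaleN1r -[_ *: _]addr0; exact: LL.
by rewrite /u /vabs hU// phid phiNd maxxx eqxx.
Qed.

Lemma fcalc_eq (n : nat) (w : ('I_n -> R) -> R) (f : 'I_n -> E) (g : E) :
  archimedean E -> is_fcalc w f g -> fcalc w f = g.
Proof.
by move=> arch hg; apply: xget_unique => // h /is_fcalc_unique; exact.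
Qed.

End LatticeHomomorphisms.

(** * Means of disjoint elements *)

Section MeansOfDisjoint.
Context {R : realType} {E : vectorLatticeType R}.
Implicit Types (x y : E).

Lemma nthroot_exp (n : nat) (a : R) : (0 < n)%N -> 0 <= a ->
  Defs.nthroot n (a ^+ n) = a.
Proof.
move=> n0; rewrite /Defs.nthroot le_eqVlt => /orP[/eqP <-|a0].
  by rewrite expr0n gtn_eqF// sgr0 mul0r.
rewrite gtr0_sg ?exprn_gt0// mul1r ger0_norm ?exprn_ge0 ?ltW//.
rewrite -powR_mulrn ?ltW// -powRrM mulfV ?powRr1 ?ltW//.
by rewrite pnatr_eq0 -lt0n.
Qed.

Lemma expfD_disjoint (n : nat) (a b : R) : (0 < n)%N -> a * b = 0 ->
  (a + b) ^+ n = a ^+ n + b ^+ n.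
Proof.
by move=> n0 /eqP; rewrite mulf_eq0 => /orP[] /eqP ->;
  rewrite expr0n gtn_eqF// ?add0r ?addr0.
Qed.

Lemma root_mean_power_disjoint (n r : nat) (i j : 'I_r) (f : 'I_r -> E) :
  archimedean E -> (0 < n)%N -> i != j -> positive_disjoint (f i) (f j) ->
  (forall k, k != i -> k != j -> f k = 0) ->
  fcalc (root_mean_power n (r := r)) f = f i + f j.
Proof.
move=> arch n0 ij fij f0; apply: fcalc_eq => // phi hom.
have Lf k : generated_sublattice (range f `|` [set f i + f j])%classic (f k).
  by apply: generated_sublattice_gen; left; exists k.
have [ai aj aij ->] := lattice_hom_on_disjoint hom (Lf i) (Lf j) fij.
have phi0 := lattice_hom_on0 hom (Lf i).
rewrite /root_mean_power (bigD1 i)//= (bigD1 j) 1?eq_sym//= big1.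
  by rewrite addr0 -expfD_disjoint// nthroot_exp// addr_ge0.
by move=> k /andP[ki kj]; rewrite f0// phi0 expr0n gtn_eqF.
Qed.

(** At a homomorphism that kills [x] one factor vanishes; at one that kills [y]
    all factors equal the value at [x]. With [n = 1] the sublattice generated
    by the arguments would not contain [y]. *)
Lemma geometric_mean_disjoint (n : nat) (i : 'I_n) x y :
  archimedean E -> (1 < n)%N -> positive_disjoint x y ->
  fcalc (geometric_mean (n := n)) [eta fun=> x + y with i |-> x] = x.
Proof.
set f := (X in fcalc _ X); move=> arch n1 xy; apply: fcalc_eq => // phi hom.
have fi : f i = x by rewrite /f /= eqxx.
have fk k : k != i -> f k = x + y by rewrite /f /= => /negPf ->.
have [j ji] : exists j : 'I_n, j != i.
  have [i0|i0] := eqVneq (val i) 0%N.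
    by exists (Ordinal n1); rewrite -val_eqE i0.
  by exists (Ordinal (ltnW n1)); rewrite -val_eqE eq_sym.
pose L := generated_sublattice (range f `|` [set x])%classic.
have Lf k : L (f k) by apply: generated_sublattice_gen; left; exists k.
have Lx : L x by rewrite -fi.
(* The j-th argument is x + y, so y is a difference of arguments. *)
have Ly : L y.
  have [_ LL _ _] : vector_sublattice L := generated_sublatticeP _.
  have := LL (-1) _ _ Lx (Lf j).
  by rewrite fk// scaleN1r addKr.
have [ax ay /eqP axy phixy] := lattice_hom_on_disjoint hom Lx Ly xy.
have phif k : (phi \o f) k = phi (f k) by [].
rewrite /geometric_mean.
have -> : \prod_(k < n) `|(phi \o f) k| = phi x ^+ n.
  move: axy; rewrite mulf_eq0 => /orP[]/eqP phi0.
    rewrite phi0 expr0n gtn_eqF ?(ltnW n1)// (bigD1 i)//.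
    by rewrite phif fi phi0 normr0; exact: mul0r.
  rewrite -[in RHS](card_ord n) -prodr_const; apply: eq_bigr => k _.
  rewrite phif.
  have [->|ki] := eqVneq k i; first by rewrite fi ger0_norm.
  by rewrite fk// phixy phi0 addr0 ger0_norm.
by rewrite nthroot_exp// ltnW.
Qed.

End MeansOfDisjoint.

(** * Polynomials in one real variable with vector coefficients *)

Section VectorPolynomials.
Context {R : realType} {E V : lmodType R}.
Implicit Types (x y : E) (t : R) (v : V).

Definition vector_polynomial (m : nat) (q : R -> V) : Prop :=
  exists c : nat -> V, forall t, q t = \sum_(k < m) t ^+ k *: c k.

Lemma vector_polynomial_cst v : vector_polynomial 1 (fun=> v).
Proof. by exists (fun=> v) => t; rewrite big_ord1 expr0 scale1r. Qed.

Lemma vector_polynomialB m q1 q2 : vector_polynomial m q1 ->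
  vector_polynomial m q2 -> vector_polynomial m (fun t => q1 t - q2 t).
Proof.
move=> [c1 h1] [c2 h2]; exists (fun k => c1 k - c2 k) => t.
by rewrite h1 h2 -sumrB; apply: eq_bigr => k _; rewrite scalerBr.
Qed.

Lemma vector_polynomialMXD m q1 q2 : vector_polynomial m q1 ->
  vector_polynomial m q2 -> vector_polynomial m.+1 (fun t => t *: q1 t + q2 t).
Proof.
move=> [c1 h1] [c2 h2].
exists (fun k => (if k is k'.+1 then c1 k' else 0) +
                 (if (k < m)%N then c2 k else 0)).
move=> t; under [RHS]eq_bigr do rewrite scalerDr.
rewrite big_split /=; congr (_ + _).
  rewrite big_ord_recl scaler0 add0r h1 scaler_sumr; apply: eq_bigr => k _.
  by rewrite scalerA -exprS.
rewrite big_ord_recr /= ltnn scaler0 addr0 h2; apply: eq_bigr => k _.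
by rewrite ltn_ord.
Qed.

(** Induction on the number of coefficients: [q (2 t) - 2 ^ m q t] has no term
    in [t ^ m], and multiplies every other coefficient by the nonzero number
    [2 ^ k - 2 ^ m]. *)
Lemma vector_polynomial_eq0 m q : vector_polynomial m q ->
  (forall t, 0 < t -> q t = 0) -> forall t, q t = 0.
Proof.
move=> [c hc] q0.
suff c0 (k : 'I_m) : c k = 0.
  by move=> t; rewrite hc big1// => k _; rewrite c0 scaler0.
have {hc q0} : forall t, 0 < t -> \sum_(k < m) t ^+ k *: c k = 0.
  by move=> t t0; rewrite -hc q0.
elim: m c k => [|m IH] c k h; first by case: k.
have cm (j : 'I_m) : c j = 0.
  have : (2 ^+ j - 2 ^+ m : R) *: c j = 0.
    apply: (IH (fun i => (2 ^+ i - 2 ^+ m : R) *: c i)) => t t0.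
    have h1 : \sum_(k < m.+1) (2 * t) ^+ k *: c k = 0 by rewrite h// mulr_gt0.
    have := congr1 (fun v => (2 ^+ m : R) *: v) (h t t0).
    rewrite scaler0 scaler_sumr -{2}h1 => /esym/eqP.
    rewrite -subr_eq0 -sumrB big_ord_recr /= scalerA exprMn subrr addr0.
    move=> /eqP h2; rewrite -[RHS]h2; apply: eq_bigr => i _.
    by rewrite exprMn !scalerA -scalerBl; congr (_ *: _); ring.
  move/eqP; rewrite scaler_eq0 subr_eq0 => /orP[/eqP h2|/eqP//].
  have := ltn_ord j.
  by rewrite -(ltr_eXn2l (x := 2 : R)) ?ltr1n// h2 ltxx.
have hk : \sum_(i < m.+1) 1 ^+ i *: c i = 0 := h 1 ltr01.
rewrite big_ord_recr /= big1 ?add0r ?expr1n ?scale1r in hk.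
  have [km|km] := ltnP k m; first exact: (cm (Ordinal km)).
  have -> : val k = m by apply/eqP; rewrite eqn_leq km -ltnS ltn_ord.
  exact: hk.
by move=> i _; rewrite cm scaler0.
Qed.

(** The arguments become affine in the parameter one at a time; an arbitrary
    [z] fills the others so that the induction hypothesis applies to both terms
    that multilinearity produces. *)
Lemma multilinear_polynomial n (M : ('I_n -> E) -> V) (x y : 'I_n -> E) :
  multilinear M ->
  vector_polynomial n.+1 (fun t => M (fun i => x i + t *: y i)).
Proof.
move=> hM.
suff h (s : seq 'I_n) (z : 'I_n -> E) : uniq s -> vector_polynomial (size s).+1
    (fun t => M (fun i => if i \in s then x i + t *: y i else z i)).
  have [c hc] := h (enum 'I_n) x (enum_uniq _).
  exists c => t; rewrite size_enum_ord in hc; rewrite -hc.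
  by congr M; apply: funext => i; rewrite mem_enum.
elim: s z => [|i s IH] z.
  by move=> _; exact: (vector_polynomial_cst (M z)).
rewrite cons_uniq => /andP[ins us].
have [c1 h1] := vector_polynomialMXD
  (IH [eta z with i |-> y i] us) (IH [eta z with i |-> x i] us).
exists c1 => t; rewrite -h1.
pose g (j : 'I_n) := if j \in s then x j + t *: y j else z j.
have gi (w : E) :
    (fun j => if j \in s then x j + t *: y j else [eta z with i |-> w] j)
    = [eta g with i |-> w].
  apply: funext => j; rewrite /g /=; case: eqVneq => [->|//].
  by rewrite (negPf ins).
rewrite !gi -hM; congr M; apply: funext => j; rewrite /g /= inE.
by case: eqVneq => [->|//]; rewrite addrC.
Qed.

End VectorPolynomials.

(** * From the positive cone to the whole vector lattice *)

Section HomogeneousPolynomials.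
Context {R : realType} {E : vectorLatticeType R} {V : lmodType R}.
Variables (n : nat) (P : E -> V) (Pc : ('I_n -> E) -> V).
Hypothesis hP : homogeneous_polynomial_with P Pc.

Lemma homogeneous_polynomial_line (x y : E) :
  vector_polynomial n.+1 (fun t : R => P (x + t *: y)).
Proof.
have [_ hM PE] := hP.
have [c hc] := multilinear_polynomial (fun=> x) (fun=> y) hM.
by exists c => t; rewrite PE hc.
Qed.

Lemma homogeneous_polynomial0 : (0 < n)%N -> P 0 = 0.
Proof.
move=> n0; have [_ hM PE] := hP; rewrite PE.
have := hM (Ordinal n0) (fun=> 0) 1 0 0.
rewrite scaler0 addr0 scale1r.
have -> : [eta (fun=> 0) with Ordinal n0 |-> 0] = (fun=> 0) :> ('I_n -> E).
  by apply: funext => i /=; case: ifP.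
by move=> /eqP; rewrite -subr_eq0 opprD addrA subrr sub0r oppr_eq0 => /eqP.
Qed.

(** With [f = f^+ - f^-] and [g = g^+ - g^-], the elements [f^+ + g^+] and
    [f^- + g^-] are disjoint, so two sign rules for disjoint positive [x], [y]
    suffice: [P (x - y) = P x + P (- y)] and
    [P (- (x + y)) = P (- x) + P (- y)]. Each is the value at [t = -1] of a
    polynomial identity valid for [t > 0]. *)
Lemma orthogonally_additive_of_positive :
  (forall x y : E, positive_disjoint x y -> P (x + y) = P x + P y) ->
  orthogonally_additive P.
Proof.
move=> hpos.
have line0 (x : E) : vector_polynomial n.+1 (fun t : R => P (t *: x)).
  have [c hc] := homogeneous_polynomial_line 0 x.
  by exists c => t; rewrite -hc add0r.
have Pcst (x : E) : vector_polynomial n.+1 (fun=> P x).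
  have [c hc] := homogeneous_polynomial_line x 0.
  by exists c => t; rewrite -hc scaler0 addr0.
have sub x y : positive_disjoint x y -> P (x - y) = P x + P (- y).
  move=> xy.
  have := vector_polynomial_eq0
    (vector_polynomialB (vector_polynomialB
      (homogeneous_polynomial_line x y) (Pcst x)) (line0 y)) _ (-1).
  rewrite scaleN1r => h; apply/eqP; rewrite -subr_eq0 [- (P _ + _)]opprD addrA.
  apply/eqP/h => t t0.
  have xty := positive_disjointZ (ltW t0) xy.
  by rewrite hpos// -addrA -opprD subrr.
have neg x y : positive_disjoint x y -> P (- (x + y)) = P (- x) + P (- y).
  move=> xy.
  have := vector_polynomial_eq0
    (vector_polynomialB (vector_polynomialB
      (line0 (x + y)) (line0 x)) (line0 y)) _ (-1).
  rewrite !scaleN1r => h; apply/eqP; rewrite -subr_eq0 [- (P _ + _)]opprD addrA.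
  apply/eqP/h => t t0.
  have txy : positive_disjoint (t *: x) (t *: y).
    apply: positive_disjointZ; first exact: ltW.
    by apply/positive_disjointC/positive_disjointZ/positive_disjointC/xy/ltW.
  by rewrite scalerDr hpos// -addrA -opprD subrr.
have split_pos x : P x = P (vpos x) + P (- vpos (- x)).
  by rewrite -sub ?vpos_subN//; exact: vpos_disjoint.
move=> f g fg.
have pp := disjoint_vpos fg; have nn := disjoint_vpos (disjointN fg).
have pn := disjoint_vpos (disjointNr fg).
have np := disjoint_vpos (disjointNl fg).
have fgE : f + g = (vpos f + vpos g) - (vpos (- f) + vpos (- g)).
  by rewrite opprD addrACA !vpos_subN.
rewrite fgE sub; last first.
  apply: positive_disjointD; apply: positive_disjointC;
    apply: positive_disjointD.
  - exact/positive_disjointC/vpos_disjoint.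
  - exact: positive_disjointC.
  - exact: np.
  - exact/positive_disjointC/vpos_disjoint.
by rewrite hpos// neg// (split_pos f) (split_pos g) addrACA.
Qed.

End HomogeneousPolynomials.

(** * Orthogonal additivity from mean identities *)

Theorem theorem2p2 (R : realType) (n r : nat) (hn : (1 < n)%N) (hr : (1 < r)%N)
    (E : vectorLatticeType R) (arch_E : archimedean E)
    (ucomplete_E : uniformly_complete E)
    (V : lmodType R) (P : E -> V) (Pc : ('I_n -> E) -> V)
    (hP : homogeneous_polynomial_with P Pc) :
  ((forall f : 'I_r -> E, (forall k, 0 <= f k) ->
      P (fcalc (root_mean_power n (r := r)) f) = \sum_(k < r) P (f k)) ->
    orthogonally_additive P)
  /\
  ((forall f : 'I_n -> E, (forall k, 0 <= f k) ->
      P (fcalc (geometric_mean (n := n)) f) = Pc f) ->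
    orthogonally_additive P).
Proof.
have n0 := ltnW hn.
split=> hmean; apply: (orthogonally_additive_of_positive hP) => x y xy;
  have [x0 y0 _] := xy.
- pose i : 'I_r := Ordinal (ltnW hr); pose j : 'I_r := Ordinal hr.
  pose f k : E := if k == i then x else if k == j then y else 0.
  have f0 k : 0 <= f k by rewrite /f; case: ifP => // _; case: ifP.
  have ij : i != j by [].
  have fi : f i = x by rewrite /f eqxx.
  have fj : f j = y by rewrite /f eqxx.
  have fk k : k != i -> k != j -> f k = 0 by rewrite /f => /negPf -> /negPf ->.
  have := hmean f f0.
  rewrite (@root_mean_power_disjoint _ _ n r i j f) ?fi ?fj// => ->.
  rewrite (bigD1 i)//= (bigD1 j) 1?eq_sym//= big1 ?fi ?fj ?addr0//.
  by move=> k /andP[ki kj]; rewrite fk// (homogeneous_polynomial0 hP).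
- have [_ hM PE] := hP; pose i : 'I_n := Ordinal n0.
  have mean z w : positive_disjoint z w ->
      Pc [eta fun=> z + w with i |-> z] = P z.
    move=> zw; have [z0 w0 _] := zw.
    rewrite -hmean ?geometric_mean_disjoint// => k /=.
    by case: ifP => // _; rewrite -[0]addr0 vleD.
  have all_sum :
      [eta fun=> x + y with i |-> 1 *: x + y] = (fun=> x + y) :> ('I_n -> E).
    by apply: funext => k /=; rewrite scale1r if_same.
  rewrite PE -all_sum hM scale1r mean// [x + y]addrC mean//.
  exact: positive_disjointC.
Qed.
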